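(* Let $Sp(K,S)$ be a split graph with s-partition $(K,S)$, $|K|\ge 2$, and biadjacency matrix $R$. Then $\dim(\operatorname{Cker}(Sp))\le 1$ and \[ \operatorname{nl}(Sp)=\begin{cases}\operatorname{nl}(R), & \text{if } \dim(\operatorname{Cker}(Sp))=0,\\ \operatorname{nl}(R)+1, & \text{if } \dim(\operatorname{Cker}(Sp))=1.\end{cases} \]
   Context: Graphs are finite and simple. A split graph is a graph $Sp$ whose vertex set is a disjoint union of a clique $K$ and an independent set $S$; the pair $(K,S)$ is called an s-partition, and $Sp(K,S)$ denotes $Sp$ together with this s-partition. Both $K$ and $S$ are assumed nonempty. With the vertices ordered as $(K,S)$, the adjacency matrix is \[A(Sp)=\begin{pmatrix} J-I & R\\ R^t & 0\end{pmatrix},\] where $J$ is an all-ones matrix, $I$ the identity, and $R$ is the $|K|\times|S|$ $0/1$ biadjacency matrix ($R_{uv}=1$ iff $u\in K$ and $v\in S$ are adjacent). All matrices are real. $\mathcal{N}(A)$ is the nullspace of a matrix $A$, $\operatorname{nl}(A)=\dim\mathcal{N}(A)$, and $\operatorname{im}(A)$ is its column space; $\operatorname{nl}(Sp)$ is the nullity of $A(Sp)$. For $|K|\ge 2$ the matrix $I-J$ of order $|K|$ is invertible, and the clique-kernel of $Sp(K,S)$ is the subspace $\operatorname{Cker}(Sp)=\mathcal{N}(R^t)\cap\operatorname{im}((I-J)^{-1}R)\subseteq\mathbb{R}^{|K|}$. *)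

(* Defs.v *)
From HB Require Import structures.
From mathcomp Require Import all_boot all_order all_algebra.
From mathcomp Require Import reals.
From mathcomp Require Import ring.

Set Implicit Arguments.
Unset Strict Implicit.
Unset Printing Implicit Defensive.

Import Order.TTheory GRing.Theory Num.Theory.
Local Open Scope ring_scope.

Section NullSpace.
Variable F : fieldType.

(* Matrices act on column vectors on the left, so these are subspaces of
   'cV_n and 'cV_m respectively (MathComp's kermx is the left kernel). *)
Definition nullspace m n (A : 'M[F]_(m, n)) : {vspace 'cV[F]_n} :=
  lker (linfun (mulmx A : 'cV[F]_n -> 'cV[F]_m)).

Definition colspace m n (A : 'M[F]_(m, n)) : {vspace 'cV[F]_m} :=
  limg (linfun (mulmx A : 'cV[F]_n -> 'cV[F]_m)).

Definition nl m n (A : 'M[F]_(m, n)) : nat := \dim (nullspace A).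

Lemma nullspaceP m n (A : 'M[F]_(m, n)) (x : 'cV[F]_n) :
  (x \in nullspace A) = (A *m x == 0).
Proof. by rewrite memv_ker lfunE. Qed.

Lemma colspaceP m n (A : 'M[F]_(m, n)) (y : 'cV[F]_m) :
  reflect (exists x : 'cV[F]_n, y = A *m x) (y \in colspace A).
Proof.
apply: (iffP memv_imgP) => [[x _ ->]|[x ->]]; exists x; rewrite ?lfunE //.
exact: memvf.
Qed.

End NullSpace.

Section SplitGraph.
Variables (T : finType) (e : rel T).

Definition clique (K : {set T}) : Prop :=
  {in K &, forall x y, x != y -> e x y}.

Definition independent (S : {set T}) : Prop :=
  {in S &, forall x y, ~~ e x y}.

Definition s_partition (K S : {set T}) : Prop :=
  [/\ K != set0, S != set0, [disjoint K & S] & K :|: S = [set: T]]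
  /\ clique K /\ independent S.

Variables (R : realType) (K S : {set T}).

(* The listing of K :|: S with the vertices of K first. *)
Definition ks_vertex (i : 'I_(#|K| + #|S|)) : T :=
  match split i with inl a => enum_val a | inr b => enum_val b end.

Definition adjmx : 'M[R]_(#|K| + #|S|) :=
  \matrix_(i, j) (e (ks_vertex i) (ks_vertex j))%:R.

Definition biadjmx : 'M[R]_(#|K|, #|S|) :=
  \matrix_(u, v) (e (enum_val u) (enum_val v))%:R.

Definition Cker : {vspace 'cV[R]_#|K|} :=
  (nullspace biadjmx^T
     :&: colspace (invmx (1%:M - const_mx 1) *m biadjmx))%VS.

Lemma adjmx_block : symmetric e -> irreflexive e -> s_partition K S ->
  adjmx = block_mx (const_mx 1 - 1%:M) biadjmx biadjmx^T 0.
Proof.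
move=> esym eirr [_ [clK indS]]; apply/matrixP => i j.
case: (split_ordP i) => a ->; case: (split_ordP j) => b ->;
  rewrite !(block_mxEul, block_mxEur, block_mxEdl, block_mxEdr) !mxE
    /ks_vertex !(unsplitK (inl _), unsplitK (inr _)) //=.
- have [->|nab] := eqVneq a b; first by rewrite eirr subrr.
  by rewrite clK ?enum_valP ?subr0 // (inj_eq enum_val_inj).
- by rewrite esym.
- by rewrite (negbTE (indS _ _ _ _)) ?enum_valP.
Qed.

End SplitGraph.

(* For n >= 2 the matrix I - J is invertible, so the invmx in Cker is a
   genuine inverse. *)
Lemma unitmx_IJ (R : realType) n :
  (1 < n)%N -> 1%:M - const_mx 1 \in @unitmx R n.
Proof.
move=> n1; pose J : 'M[R]_n := const_mx 1.
have JJ : J *m J = n%:R *: J.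
  apply/matrixP => i j; rewrite !mxE (eq_bigr (fun=> 1)) => [|k _].
    by rewrite sumr_const card_ord mulr1.
  by rewrite !mxE mulr1.
have n0 : n%:R - 1 != 0 :> R by rewrite subr_eq0 pnatr_eq1 gtn_eqF.
have : (1%:M - J) *m (1%:M - (n%:R - 1)^-1 *: J) = 1%:M.
  rewrite mulmxBl mul1mx mulmxBr mulmx1 -scalemxAr JJ scalerA.
  by apply/matrixP => i j; rewrite !mxE; move: (_ == _)%:R => d; field.
by case/mulmx1_unit.
Qed.

(* Main.v *)
Require Import Defs.
From HB Require Import structures.
From mathcomp Require Import all_boot all_order all_algebra.
From mathcomp Require Import reals.

Set Implicit Arguments.
Unset Strict Implicit.
Unset Printing Implicit Defensive.

Import Order.TTheory GRing.Theory Num.Theory.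
Local Open Scope ring_scope.

(** Projecting the null vectors [(x, y)] of [A(Sp)] to [x] maps the nullspace
    onto the clique-kernel, with kernel [N(R)]; hence [nl(Sp)] is
    [nl(R) + dim Cker(Sp)].  For [x] in the clique-kernel, [(I - J) x = R y] for
    some [y] and [R^t x = 0], so [x^t (I - J) x = 0], i.e., [x^t x] is the square
    of the coordinate sum of [x].  The coordinate sum is therefore injective on
    the clique-kernel, whose dimension is thus at most 1. *)

Lemma nl_block_mx (F : fieldType) (m n p : nat) (M : 'M[F]_m)
    (B : 'M[F]_(m, n)) (C : 'M[F]_(p, m)) :
  M \in unitmx ->
  nl (block_mx (- M) B C 0) =
    (nl B + \dim (nullspace C :&: colspace (invmx M *m B))%VS)%N.
Proof.
move=> uM; set A := block_mx _ _ _ _.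
(* The upper block row reads [- M x + B y = 0]. As [M] is invertible, this says [x = M^-1 B y],
   which is why the column space of [invmx M *m B] appears. *)
have AP x y : (col_mx x y \in nullspace A) =
    (M *m x == B *m y) && (C *m x == 0).
  rewrite nullspaceP mul_block_col mul0mx addr0 col_mx_eq0 mulNmx addrC.
  by rewrite subr_eq0 eq_sym.
pose proj : 'Hom('cV[F]_(m + n), 'cV[F]_m) := linfun usubmx.
pose inj : 'Hom('cV[F]_n, 'cV[F]_(m + n)) := linfun (mulmx (col_mx 0 1%:M)).
have injE y : inj y = col_mx 0 y by rewrite lfunE /= mul_col_mx mul0mx mul1mx.
have img_proj : (proj @: nullspace A)%VS =
    (nullspace C :&: colspace (invmx M *m B))%VS.
  apply/vspaceP => x; rewrite memv_cap nullspaceP.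
  apply/memv_imgP/andP => [[z zA ->]|[Cx /colspaceP[y xE]]].
    rewrite lfunE /=; move: zA; rewrite -{1}[z]vsubmxK AP.
    case/andP=> /eqP Mx Cx; split=> //; apply/colspaceP; exists (dsubmx z).
    by rewrite -mulmxA -Mx mulKmx.
  exists (col_mx x y); last by rewrite lfunE /= col_mxKu.
  by rewrite AP Cx xE -mulmxA mulKVmx ?eqxx.
have ker_proj : (nullspace A :&: lker proj)%VS = (inj @: nullspace B)%VS.
  apply/vspaceP => z; rewrite memv_cap (memv_ker proj) lfunE /=.
  apply/andP/memv_imgP => [[zA /eqP z0]|[y yB ->]].
    exists (dsubmx z); last by rewrite injE -z0 vsubmxK.
    move: zA; rewrite -{1}[z]vsubmxK z0 AP nullspaceP mulmx0 eq_sym.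
    by case/andP.
  rewrite injE AP col_mxKu !mulmx0 !eqxx andbT eq_sym.
  by move: yB; rewrite nullspaceP => ->.
(* Rank-nullity for [proj] restricted to the nullspace of [A]; what remains is that [inj] is
   injective, so that it preserves the dimension of [nullspace B]. *)
rewrite /nl -(limg_ker_dim proj (nullspace A)) img_proj ker_proj limg_dim_eq //.
apply/eqP; rewrite -subv0; apply/subvP => y.
by rewrite memv_cap (memv_ker inj) injE col_mx_eq0 memv0 => /and3P[].
Qed.

Lemma dim_clique_kernel_le1 (F : realFieldType) (m n : nat)
    (B : 'M[F]_(m, n)) :
  1%:M - const_mx 1 \in @unitmx F m ->
  (\dim (nullspace B^T :&: colspace (invmx (1%:M - const_mx 1)%R *m B))%VS
     <= 1)%N.
Proof.
move=> uM; set U := (_ :&: _)%VS.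
pose sum : 'Hom('cV[F]_m, 'cV[F]_1) := linfun (mulmx (const_mx 1)).
(* The target of [sum] has dimension 1, so a trivial kernel of [sum] on [U] gives the bound. *)
rewrite -(@limg_dim_eq _ _ _ sum U).
  by apply: leq_trans (dimvS (subvf _)) _; rewrite dimvf.
apply/eqP; rewrite -subv0; apply/subvP => x.
rewrite !memv_cap (memv_ker sum) memv0 lfunE /= nullspaceP.
case/andP=> /andP[/eqP Bx /colspaceP[y xE]] /eqP sum0.
have Jx : (const_mx 1 : 'M[F]_m) *m x = 0.
  apply/matrixP => i j; move/matrixP/(_ 0 j): sum0; rewrite !mxE; apply: etrans.
  by apply: eq_bigr => k _; rewrite !mxE.
(* Once [J x = 0], the equation [(I - J) x = B y] loses its [J] term. So [x] lies in the column
   space of [B], to which [B^T x = 0] makes it orthogonal. *)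
have xB : x = B *m y.
  by rewrite -[B](mulKVmx uM) -[LHS]mul1mx -mulmxA -xE mulmxBl Jx subr0.
have : (x^T *m x) 0 0 = 0.
  by rewrite {2}xB mulmxA -[B]trmxK -trmx_mul Bx trmx0 mul0mx mxE.
rewrite mxE => /eqP; rewrite psumr_eq0 => [/allP x0|i _]; last first.
  by rewrite mxE -expr2 sqr_ge0.
apply/eqP/matrixP => i j; rewrite ord1.
by move: (x0 i (mem_index_enum i)); rewrite !mxE mulf_eq0 orbb => /eqP.
Qed.

Theorem corollary5p4 (R : realType) (T : finType) (e : rel T)
    (e_sym : symmetric e) (e_irr : irreflexive e) (K S : {set T})
    (hKS : s_partition e K S) (hK : (2 <= #|K|)%N) :
  (\dim (Cker e R K S) <= 1)%N /\
  (\dim (Cker e R K S) = 0%N -> nl (adjmx e R K S) = nl (biadjmx e R K S)) /\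
  (\dim (Cker e R K S) = 1%N ->
     nl (adjmx e R K S) = (nl (biadjmx e R K S)).+1).
Proof.
have uIJ := unitmx_IJ R hK.
have nlE : nl (adjmx e R K S) = (nl (biadjmx e R K S) + \dim (Cker e R K S))%N.
  (* The clique block [J - I] is rewritten as [- (I - J)], so that [M] is [I - J]. *)
  by rewrite adjmx_block // -opprB nl_block_mx.
split; first exact: dim_clique_kernel_le1.
by rewrite nlE; split=> ->; rewrite ?addn0 ?addn1.
Qed.
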